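(* Let $a<b$, $n\ge1$, and let $I_n: a=x_0<x_1<\cdots<x_n=b$ be the uniform partition with $x_{i+1}-x_i=h=\frac{b-a}{n}$ for $i=0,\dots,n-1$. Let $f:[a,b]\rightarrow\mathbb{R}$ be an absolutely continuous mapping with $f'\in L^2[a,b]$, and let $\sigma(f')=\|f'\|_2^2-\frac{(f(b)-f(a))^2}{b-a}$. Define \[ S(f,I_n)=\frac{h}{2}\sum_{i=0}^{n-1}\left[f\left(\frac{3x_i+x_{i+1}}{4}\right)+f\left(\frac{x_i+3x_{i+1}}{4}\right)\right] \] and $R(f,I_n)=\int_a^b f(x)\,dx-S(f,I_n)$. Then \[ |R(f,I_n)|\leq \frac{(b-a)^{3/2}}{4\sqrt{3}\,n} \sqrt{\sigma(f')}. \]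
   Context: $\|g\|_2=\left(\int_a^b g(t)^2\,dt\right)^{1/2}$. *)

(* Defs.v *)
From HB Require Import structures.
From mathcomp Require Import all_boot all_order all_algebra.
From mathcomp Require Import all_classical all_reals all_analysis.
Set Implicit Arguments. Unset Strict Implicit. Unset Printing Implicit Defensive.
Import Order.TTheory GRing.Theory Num.Theory.
Import numFieldNormedType.Exports.
Local Open Scope classical_set_scope.
Local Open Scope ring_scope.

Definition abs_continuous_on (R : realType) (a b : R) (f : R -> R) : Prop :=
  forall e : R, 0 < e -> exists2 d : R, 0 < d &
    forall (m : nat) (s t : nat -> R),
      (forall k, (k < m)%N -> a <= s k /\ s k <= t k /\ t k <= b) ->
      (forall k l, (k < m)%N -> (l < m)%N -> k <> l -> t k <= s l \/ t l <= s k) ->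
      \sum_(k < m) (t k - s k) < d ->
      \sum_(k < m) `|f (t k) - f (s k)| < e.

Definition unif_node (R : realType) (a b : R) (n i : nat) : R :=
  a + i%:R * ((b - a) / n%:R).

Definition S_quad (R : realType) (a b : R) (n : nat) (f : R -> R) : R :=
  ((b - a) / n%:R) / 2 *
  \sum_(i < n) (f ((3 * unif_node a b n i + unif_node a b n i.+1) / 4)
              + f ((unif_node a b n i + 3 * unif_node a b n i.+1) / 4)).

Definition L2norm_sq (R : realType) (a b : R) (g : R -> R) : R :=
  Rintegral lebesgue_measure `[a, b] (fun t => g t ^+ 2).

Definition sigma_d (R : realType) (a b : R) (f : R -> R) : R :=
  L2norm_sq a b (derive1 f) - (f b - f a) ^+ 2 / (b - a).

Definition R_rem (R : realType) (a b : R) (n : nat) (f : R -> R) : R :=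
  Rintegral lebesgue_measure `[a, b] f - S_quad a b n f.

(* Main.v *)
Require Import Defs.
From HB Require Import structures.
From mathcomp Require Import all_boot all_order all_algebra.
From mathcomp Require Import all_classical all_reals all_analysis.
From mathcomp Require Import measurable_realfun ring lra.
Import Order.TTheory GRing.Theory Num.Theory.
Import numFieldNormedType.Exports.
Local Open Scope classical_set_scope.
Local Open Scope ring_scope.
Set Implicit Arguments.
Unset Strict Implicit.

(* Extend a function [G] that is nondecreasing and absolutely continuous on
    [[a, b]] by constants.  Absolute continuity, applied to the cells of finer and
    finer uniform partitions contained in an open set of small measure, shows that
    the Lebesgue-Stieltjes measure of [G] is dominated by Lebesgue measure, so by
    Radon-Nikodym [G] is the primitive of an integrable function.  An absolutely
    continuous [f] is a difference of two such functions (the total variation of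
    [f] is again absolutely continuous), and Lebesgue differentiation identifies
    the density with [f'] almost everywhere.

    The quadrature is the midpoint rule on [2 n] cells.  On each half cell of width
    [v] with midpoint [y] as one end and [z] as the other, the fundamental theorem
    for [(z - x) (f x - f y)] gives the Peano kernel [z - x]; completing the square
    against [f' - c], [c = (f b - f a) / (b - a)], and summing yields
    [2 al R <= al ^ 2 (b - a) ^ 3 / (48 n ^ 2) + sigma] for every [al], which is the
    theorem after optimizing [al]. *)

(** * Total variation of absolutely continuous functions *)

(** Intervals are pairs of endpoints and the predicates are boolean, so [all], [pairwise] and
    permutations of lists apply. Degenerate intervals and shared endpoints are allowed, as in
    [abs_continuous_on]. *)
Definition sub_itv {R : realType} (a b : R) (p : R * R) := [&& a <= p.1, p.1 <= p.2 & p.2 <= b].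
Definition itv_disj {R : realType} (p q : R * R) := (p.2 <= q.1) || (q.2 <= p.1).

(** Lists replace indexed families because the induction on total variation concatenates and
    permutes families. The pair [e], [d] is fixed, so the same [d] serves throughout that
    induction. *)
Lemma ac_seq (R : realType) (a b e d : R) (f : R -> R) :
  (forall (m : nat) (s t : nat -> R),
      (forall k, (k < m)%N -> a <= s k /\ s k <= t k /\ t k <= b) ->
      (forall k l, (k < m)%N -> (l < m)%N -> k <> l -> t k <= s l \/ t l <= s k) ->
      \sum_(k < m) (t k - s k) < d ->
      \sum_(k < m) `|f (t k) - f (s k)| < e) ->
  forall L : seq (R * R), all (sub_itv a b) L -> pairwise itv_disj L ->
    \sum_(p <- L) (p.2 - p.1) < d -> \sum_(p <- L) `|f p.2 - f p.1| < e.
Proof.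
move=> H L /allP Lab Ldisj.
rewrite !(big_nth (0, 0)) !big_mkord.
apply: (H (size L) (fun k => (nth (0, 0) L k).1) (fun k => (nth (0, 0) L k).2)).
  by move=> k kL; have /and3P[] := Lab _ (mem_nth (0, 0) kL).
move=> k l kL lL kl; move/pairwiseP: Ldisj => /(_ (0,0)) D.
have [lt_kl|lt_lk|//] := ltngtP k l.
  by have /orP := D _ _ kL lL lt_kl.
by have /orP[|] := D _ _ lL kL lt_lk; [right|left].
Qed.

Lemma sub_itvW (R : realType) (a b c d : R) (p : R * R) :
  c <= a -> b <= d -> sub_itv a b p -> sub_itv c d p.
Proof.
by move=> ca bd /and3P[ap pp pb]; rewrite /sub_itv (le_trans ca)// pp (le_trans pb).
Qed.

(** Zipping a partition with its shift lists its cells. Their lengths telescope, so replacing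
    [(s, t)] by these cells does not change the total length of a family. *)
Lemma itv_partition_pieces (R : realType) (s t : R) (f : R -> R) (u : seq R) :
  itv_partition s t u -> let P := zip (s :: u) u in
  [/\ all (sub_itv s t) P, pairwise itv_disj P,
    \sum_(p <- P) (p.2 - p.1) = t - s &
    \sum_(p <- P) `|f p.2 - f p.1| = variation s t f u].
Proof.
move=> /[dup] stu0 [stu lstu].
have -> : variation s t f u = \sum_(p <- zip (s :: u) u) `|f p.2 - f p.1|.
  rewrite variation_zip//.
  by elim: u s {stu0 stu lstu} => [|h u IH] s /=; rewrite ?big_nil// !big_cons IH.
elim: u s {stu0} stu lstu => [|h u IH] s /=.
  by move=> _ /eqP ->; rewrite !big_nil subrr.
move=> /andP[sh hu] ut.
have [Pht Pd Ps _] := IH _ hu ut.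
have ht : h <= t := itv_partition_le (conj hu ut).
split => //.
- rewrite /sub_itv/= lexx (ltW sh) ht/=.
  by apply: sub_all Pht => p; apply: sub_itvW => //; exact: ltW.
- rewrite Pd andbT; apply: sub_all Pht => p /and3P[hp _ _].
  by rewrite /itv_disj/= hp.
- by rewrite big_cons Ps/= addrC subrKA.
Qed.

(* Replacing one interval of [L] by the pieces of a partition moves it to [M],
   and the supremum over partitions is taken one interval at a time. *)
Lemma ac_tv_seq (R : realType) (a b e d : R) (f : R -> R) :
  (forall L : seq (R * R), all (sub_itv a b) L -> pairwise itv_disj L ->
    \sum_(p <- L) (p.2 - p.1) < d -> \sum_(p <- L) `|f p.2 - f p.1| < e) ->
  forall L M : seq (R * R), all (sub_itv a b) (L ++ M) -> pairwise itv_disj (L ++ M) ->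
    \sum_(p <- L ++ M) (p.2 - p.1) < d ->
    (\sum_(p <- L) total_variation p.1 p.2 f + \sum_(p <- M) `|f p.2 - f p.1|%:E <= e%:E)%E.
Proof.
move=> H; elim=> [|[s t] L IH] M /=.
  rewrite big_nil add0e => Mab Md Mlt.
  by rewrite sumEFin lee_fin ltW// H.
move=> /andP[/and3P[/= as_ st tb] LMab] /andP[stLM LMd].
rewrite !big_cons/= => LMlt.
have LM0 : (0 <= \sum_(p <- L) total_variation p.1 p.2 f +
    \sum_(p <- M) `|f p.2 - f p.1|%:E)%E.
  move: LMab; rewrite all_cat => /andP[/allP Lab _].
  apply: adde_ge0; last by rewrite sumEFin lee_fin sumr_ge0.
  rewrite big_seq; apply: sume_ge0 => p pL.
  by apply: total_variation_ge0; have /and3P[] := Lab _ pL.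
have LMe : (\sum_(p <- L) total_variation p.1 p.2 f +
    \sum_(p <- M) `|f p.2 - f p.1|%:E <= e%:E)%E.
  apply: IH => //; apply: le_lt_trans LMlt.
  by rewrite lerDr subr_ge0.
(* Finiteness of the rest of the sum allows subtracting it in the extended reals, which isolates the
   supremum over partitions of [[s, t]]. *)
have LMfin : (\sum_(p <- L) total_variation p.1 p.2 f +
    \sum_(p <- M) `|f p.2 - f p.1|%:E)%E \is a fin_num.
  by rewrite ge0_fin_numE// (le_lt_trans LMe)// ltry.
rewrite -addeA -leeBrDr//.
apply: ge_ereal_sup => _ [_ [u stu <-] <-].
rewrite leeBrDr//.
have [Pst Pd Ps <-] := itv_partition_pieces f stu.
set P := zip _ _ in Pst Pd Ps *.
apply: le_trans (IH (P ++ M) _ _ _); last 3 first.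
- move: LMab; rewrite !all_cat => /andP[-> ->]; rewrite andbT /=.
  by apply: sub_all Pst => p; exact: sub_itvW.
(* A piece of [(s, t)] lies inside it, hence on the same side of every other interval as [(s, t)]
   itself. *)
- have PLM q r : q \in P -> r \in L ++ M -> itv_disj q r.
    move=> /(allP Pst)/and3P[sq _ qt] /(allP stLM).
    rewrite /itv_disj/= => /orP[tr|rs]; apply/orP; [left|right].
      exact: le_trans tr.
    exact: le_trans sq.
  move: LMd; rewrite !pairwise_cat allrel_catr => /and3P[LM -> ->].
  rewrite LM Pd/= !andbT; apply/andP; split; apply/allrelP => q r.
    by move=> qL rP; rewrite /itv_disj orbC; apply: PLM; rewrite ?mem_cat ?qL.
  by move=> qP rM; apply: PLM; rewrite ?mem_cat ?rM ?orbT.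
- rewrite (perm_big (P ++ L ++ M)); last by rewrite perm_catCA.
  by rewrite big_cat/= Ps.
by rewrite big_cat/= -sumEFin addeCA.
Qed.

Lemma ac_total_variation_seq (R : realType) (a b : R) (f : R -> R) :
  abs_continuous_on a b f -> forall e, 0 < e -> exists2 d, 0 < d &
  forall L : seq (R * R), all (sub_itv a b) L -> pairwise itv_disj L ->
    \sum_(p <- L) (p.2 - p.1) < d -> (\sum_(p <- L) total_variation p.1 p.2 f <= e%:E)%E.
Proof.
move=> acf e /acf[d d0 H]; exists d => // L Lab Ld Llt.
have := @ac_tv_seq _ _ _ _ _ _ (ac_seq H) L [::]; rewrite cats0 big_nil adde0; exact.
Qed.

(** Take the [d] associated with the bound 1 and cut [[a, b]] into cells shorter than [d]: each has
    variation at most 1, so the total is at most the number of cells. *)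
Lemma ac_bounded_variation (R : realType) (a b : R) (f : R -> R) :
  a <= b -> abs_continuous_on a b f -> bounded_variation a b f.
Proof.
move=> ab acf; apply/(bounded_variationP f ab).
have [d d0 H] := ac_total_variation_seq acf ltr01.
pose n := Num.bound ((b - a) / d); pose h := (b - a) / n.+1%:R.
have hd : h < d.
  rewrite /h ltr_pdivrMr ?ltr0n// mulrC -ltr_pdivrMr//.
  rewrite (lt_trans (archi_boundP _)) ?ltr_nat//.
  by rewrite divr_ge0 ?subr_ge0// ltW.
have h0 : 0 <= h by rewrite divr_ge0 ?subr_ge0// ler0n.
have hn : a + n.+1%:R * h = b by rewrite /h mulrC divfK ?pnatr_eq0// addrC subrK.
suff : forall k, (k <= n.+1)%N -> (total_variation a (a + k%:R * h) f <= k%:R%:E)%E.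
  move=> /(_ n.+1 (leqnn _)); rewrite hn => TVn.
  by rewrite ge0_fin_numE ?total_variation_ge0// (le_lt_trans TVn)// ltry.
elim=> [|k IH] kn; first by rewrite mul0r addr0 total_variationxx.
have kh0 : 0 <= k%:R * h by rewrite mulr_ge0// ler0n.
have kh : a + k.+1%:R * h = a + k%:R * h + h by rewrite -natr1; ring.
rewrite (@total_variationD _ _ _ (a + k%:R * h)) ?lerDl ?kh ?lerDl//.
rewrite -natr1 EFinD leeD// ?IH//; first exact: ltnW.
have := H [:: (a + k%:R * h, a + k%:R * h + h)].
rewrite !big_seq1/=; apply => //; last by rewrite addrC addKr.
rewrite /sub_itv/= lerDl kh0 lerDl h0 -kh -hn andbT lerD2l ler_wpM2r//.
by rewrite ler_nat.
Qed.

Lemma ac_total_variation (R : realType) (a b : R) (f : R -> R) :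
  a <= b -> abs_continuous_on a b f ->
  abs_continuous_on a b (fine \o (total_variation a ^~ f)).
Proof.
move=> ab acf e e0.
have bvf := ac_bounded_variation ab acf.
have fin_tv u v : a <= u -> u <= v -> v <= b -> total_variation u v f \is a fin_num.
  move=> au uv vb; apply/bounded_variationP => //.
  apply: (bounded_variationr au uv); exact: (bounded_variationl (le_trans au uv) vb).
(* Suprema only give a non-strict bound; halving [e] restores the strict one. *)
have [|d d0 H] := @ac_total_variation_seq _ _ _ _ acf (e / 2); first by rewrite divr_gt0.
exists d => // m s t Hst Hdisj Hd.
have := H [seq (s k, t k) | k <- index_iota 0 m].
rewrite !big_map !big_mkord => {}H.
have {}H : (\sum_(k < m) total_variation (s k) (t k) f <= (e / 2)%:E)%E.
  apply: H => //.
    apply/allP => p /mapP[k]; rewrite mem_index_iota => /= km -> .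
    by apply/and3P; have [? []] := Hst _ km.
  rewrite pairwise_map; apply/(pairwiseP 0) => i j.
  rewrite !inE size_iota subn0 => im jm ij; rewrite !nth_iota ?subn0// !add0n.
  by apply/orP; apply: Hdisj => //; apply/eqP; rewrite ltn_eqF.
apply: le_lt_trans (_ : e / 2 < e); last by rewrite ltr_pdivrMr// ltr_pMr// ltr1n.
rewrite -lee_fin -sumEFin; apply: le_trans H; apply: lee_sum => k _.
have [ask [skt tkb]] := Hst _ (ltn_ord k).
rewrite /= (total_variationD f ask skt) fineD ?fin_tv// ?(le_trans skt)//.
rewrite addrAC subrr add0r ger0_norm ?fine_ge0 ?total_variation_ge0//.
by rewrite fineK// fin_tv.
Qed.

(** * Stieltjes measure of a monotone absolutely continuous function *)

Lemma unif_node0 (R : realType) (a b : R) n : unif_node a b n 0 = a.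
Proof. by rewrite /unif_node mul0r addr0. Qed.

Lemma unif_node_last (R : realType) (a b : R) n : (0 < n)%N -> unif_node a b n n = b.
Proof.
by move=> n0; rewrite /unif_node mulrC divfK ?subrKC// pnatr_eq0 -lt0n.
Qed.

Lemma unif_nodeS (R : realType) (a b : R) n i :
  unif_node a b n i.+1 = unif_node a b n i + (b - a) / n%:R.
Proof. by rewrite /unif_node -natr1; ring. Qed.

Lemma le_unif_node (R : realType) (a b : R) n i j :
  a <= b -> (i <= j)%N -> unif_node a b n i <= unif_node a b n j.
Proof.
move=> ab ij; rewrite /unif_node lerD2l ler_wpM2r ?ler_nat//.
by rewrite divr_ge0 ?subr_ge0.
Qed.

Lemma unif_node_cell (R : realType) (a b x : R) n : (0 < n)%N -> a < x -> x <= b ->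
  exists i : 'I_n, unif_node a b n i < x <= unif_node a b n i.+1.
Proof.
move=> n0 ax xb.
have ex : exists k, x <= unif_node a b n k by exists n; rewrite unif_node_last.
(* The least index whose node reaches [x] is the right end of the cell; it is not 0 because
   [a < x]. *)
have [[|k] xk kmin] := ex_minnP ex.
  by move: xk; rewrite unif_node0 leNgt ax.
have kn : (k < n)%N.
  by apply: kmin; rewrite unif_node_last.
exists (Ordinal kn); rewrite /= xk andbT ltNge; apply/negP => /kmin.
by rewrite ltnn.
Qed.

(** Unselected cells are shrunk to their left endpoint, so they add nothing to either sum and all
    [n] indices can be kept. *)
Lemma ac_unif_cells (R : realType) (a b : R) (f : R -> R) :
  a <= b -> abs_continuous_on a b f -> forall e, 0 < e -> exists2 d, 0 < d &
  forall n (P : pred 'I_n), \sum_(i < n | P i) ((b - a) / n%:R) < d ->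
    \sum_(i < n | P i) `|f (unif_node a b n i.+1) - f (unif_node a b n i)| < e.
Proof.
move=> ab acf e /acf[d d0 H]; exists d => // n P Pd.
(* [Q] extends [P] to all naturals, since the endpoint families are indexed by [nat]. *)
pose Q k := if insub k is Some i then P i else false.
have QP (i : 'I_n) : Q i = P i by rewrite /Q valK.
have := H n (unif_node a b n)
  (fun k => if Q k then unif_node a b n k.+1 else unif_node a b n k).
rewrite (eq_bigr (fun i : 'I_n => if P i then (b - a) / n%:R else 0)); last first.
  by move=> i _; rewrite QP; case: ifP => _; rewrite ?subrr// unif_nodeS addrC addKr.
rewrite -big_mkcond [X in _ -> _ -> _ -> X < _](eq_bigr (fun i : 'I_n =>
    if P i then `|f (unif_node a b n i.+1) - f (unif_node a b n i)| else 0)); last first.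
  by move=> i _; rewrite QP; case: ifP => _; rewrite ?subrr ?normr0.
rewrite -big_mkcond; apply => //.
  move=> k kn; have n0 : (0 < n)%N by apply: leq_trans kn.
  have ak : a <= unif_node a b n k by rewrite -[leLHS](unif_node0 a b n) le_unif_node.
  have kb : unif_node a b n k.+1 <= b.
    by rewrite -[leRHS](unif_node_last a b n0) le_unif_node.
  by case: ifP => _; split => //; split => //; rewrite ?(le_trans _ kb)// ?le_unif_node.
have lt_disj k l : (k < l)%N ->
    (if Q k then unif_node a b n k.+1 else unif_node a b n k) <= unif_node a b n l.
  by move=> kl; case: ifP => _; rewrite le_unif_node// ltnW.
by move=> k l _ _ /eqP; rewrite neq_ltn => /orP[/lt_disj|/lt_disj]; [left|right].
Qed.

Lemma ac_dist (R : realType) (a b : R) (f : R -> R) :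
  abs_continuous_on a b f -> forall e, 0 < e -> exists2 d, 0 < d &
  forall x y, x \in `[a, b] -> y \in `[a, b] -> `|x - y| < d -> `|f x - f y| < e.
Proof.
move=> acf e /acf[d d0 H]; exists d => // x y.
wlog xy : x y / y <= x.
  move=> wlg xab yab; have [yx|/ltW xy] := leP y x; first exact: wlg.
  by rewrite distrC (distrC (f x)); exact: wlg.
rewrite !in_itv/= => /andP[ax xb] /andP[ay yb].
have := H 1%N (fun=> y) (fun=> x); rewrite !big_ord1 => {}H.
rewrite ger0_norm ?subr_ge0// => /H; apply => //.
by move=> [|k] [|l].
Qed.

(** The retraction of the line onto [[a, b]]; composing with it extends a function by constants. It
    is monotone and 1-Lipschitz, so it preserves monotonicity and continuity. *)
Definition clamp (R : realType) (a b x : R) : R := Num.max a (Num.min b x).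

Lemma clamp_itv (R : realType) (a b x : R) : a <= b -> clamp a b x \in `[a, b].
Proof. by move=> ab; rewrite in_itv/= /clamp le_max lexx/= ge_max ab ge_min lexx. Qed.

Lemma clamp_id (R : realType) (a b x : R) : x \in `[a, b] -> clamp a b x = x.
Proof.
by rewrite in_itv/= => /andP[ax xb]; rewrite /clamp (min_idPr xb) (max_idPr ax).
Qed.

Lemma le_clamp (R : realType) (a b x y : R) : x <= y -> clamp a b x <= clamp a b y.
Proof.
move=> xy; rewrite /clamp ge_max !le_max lexx/= ge_min le_min ge_min lexx/=.
by rewrite ge_min xy orbT/= orbT.
Qed.

Lemma clamp_dist (R : realType) (a b x y : R) : `|clamp a b x - clamp a b y| <= `|x - y|.
Proof.
wlog xy : x y / y <= x.
  move=> wlg; have [yx|/ltW xy] := leP y x; first exact: wlg.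
  by rewrite distrC (distrC x); exact: wlg.
rewrite !ger0_norm ?subr_ge0 ?le_clamp// lerBlDr {1}/clamp ge_max.
apply/andP; split; first by rewrite -[leLHS]add0r lerD ?subr_ge0// /clamp le_max lexx.
rewrite -lerBlDl /clamp le_max le_min; apply/orP; right; apply/andP; split.
  by rewrite lerBlDr ge_min lerDl subr_ge0 xy.
by rewrite lerBlDr subrKC ge_min lexx orbT.
Qed.

Lemma ac_clamp_continuous (R : realType) (a b : R) (f : R -> R) :
  a <= b -> abs_continuous_on a b f -> continuous (f \o clamp a b).
Proof.
move=> ab acf x; apply/cvgrPdist_lt => e /(ac_dist acf)[d d0 H].
near=> y; apply: H; rewrite ?clamp_itv//.
apply: le_lt_trans (clamp_dist _ _ _ _) _.
by near: y; apply: cvgr_dist_lt.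
Unshelve. all: by end_near. Qed.

Lemma ac_continuous_within (R : realType) (a b : R) (f : R -> R) :
  a <= b -> abs_continuous_on a b f -> {within `[a, b], continuous f}.
Proof.
move=> ab acf; apply: (@subspace_eq_continuous _ _ _ (f \o clamp a b)).
  by move=> x; rewrite inE /= => xab; rewrite /= clamp_id.
exact/continuous_subspaceT/ac_clamp_continuous.
Qed.

Lemma lebesgue_stieltjes_measure_itvoc (R : realType) (f : cumulative R R) (s t : R) :
  s <= t -> lebesgue_stieltjes_measure f `]s, t]%classic = (f t - f s)%:E.
Proof.
move=> st; rewrite /lebesgue_stieltjes_measure/= /measure_extension/=.
rewrite measurable_mu_extE/=; last exact: is_ocitv.
by rewrite wlength_itv_bnd.
Qed.

Section monotone_ac.
Variables (R : realType) (a b : R) (G : R -> R).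
Hypotheses (ab : a <= b) (ndG : {in `[a, b] &, nondecreasing_fun G}).
Hypothesis acG : abs_continuous_on a b G.

Lemma clamp_nondecreasing : nondecreasing_fun (G \o clamp a b).
Proof. by move=> x y xy; apply: ndG; rewrite ?clamp_itv// le_clamp. Qed.

Lemma clamp_right_continuous : right_continuous (G \o clamp a b).
Proof. exact/right_continuousW/ac_clamp_continuous. Qed.

Definition clamp_cumulative : cumulative R R :=
  HB.pack (G \o clamp a b) (isCumulative.Build R _ R _ clamp_nondecreasing clamp_right_continuous).

Local Notation nu := (lebesgue_stieltjes_measure clamp_cumulative).

Lemma clamp_measure_itv (s t : R) : a <= s -> s <= t -> t <= b ->
  nu `]s, t]%classic = (G t - G s)%:E.
Proof.
move=> as_ st tb; rewrite lebesgue_stieltjes_measure_itvoc//= !clamp_id// in_itv/=.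
  by rewrite as_ (le_trans st).
by rewrite (le_trans as_ st).
Qed.


(** * Inner approximation of open sets by cells of uniform partitions *)

Local Notation mu := (@lebesgue_measure R).

Definition unif_cell n i : set (measurableTypeR R) :=
  `]unif_node a b n i, unif_node a b n i.+1]%classic.

Lemma measurable_unif_cell n i : measurable (unif_cell n i).
Proof. exact: measurable_itv. Qed.

Lemma trivIset_unif_cell n : trivIset setT (fun i : 'I_n => unif_cell n i).
Proof.
apply/trivIsetP => i j _ _.
wlog ij : i j / (i < j)%N.
  move=> wlg; rewrite neq_ltn => /orP[ij|ji]; first by apply: wlg; rewrite // neq_ltn ij.
  by rewrite setIC; apply: wlg; rewrite // neq_ltn ji.
move=> _; rewrite -subset0 => x; rewrite /unif_cell/= !in_itv/= => -[/andP[_ xi] /andP[jx _]].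
by have := lt_le_trans jx xi; rewrite ltNge le_unif_node.
Qed.

(** A finite disjoint union inside [U] on which the Lebesgue and Stieltjes measures are both
    explicit sums, so that absolute continuity compares them. *)
Definition unif_inner (U : set R) n : set (measurableTypeR R) :=
  \big[setU/set0]_(i < n | `[< unif_cell n i `<=` U >]) unif_cell n i.

Lemma measurable_unif_inner U n : measurable (unif_inner U n).
Proof. by apply: bigsetU_measurable => i _; exact: measurable_unif_cell. Qed.

Lemma unif_inner_sub U n : unif_inner U n `<=` U.
Proof. by rewrite /unif_inner -bigcup_seq_cond => x [k /= /andP[_ /asboolP]]; apply. Qed.

Lemma lebesgue_unif_inner U n :
  mu (unif_inner U n) = (\sum_(i < n | `[< unif_cell n i `<=` U >]) ((b - a) / n%:R))%:E.
Proof.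
rewrite /unif_inner measure_bigsetU_ord; last 2 first.
- by move=> i; exact: measurable_unif_cell.
- exact: trivIset_unif_cell.
rewrite -sumEFin; apply: eq_bigr => i _.
rewrite /unif_cell [LHS]lebesgue_measure_itv/= lte_fin.
rewrite unif_nodeS ltrDl -EFinB (addrC (unif_node _ _ _ _)) addrK; case: ifPn => //.
(* Degenerate case: the width is not positive, hence zero, like the measure of the empty cell. *)
rewrite -leNgt => h0; congr EFin; apply/eqP; rewrite eq_le h0.
by rewrite divr_ge0 ?subr_ge0.
Qed.

Lemma clamp_measure_unif_inner U n :
  nu (unif_inner U n) = (\sum_(i < n | `[< unif_cell n i `<=` U >])
    `|G (unif_node a b n i.+1) - G (unif_node a b n i)|)%:E.
Proof.
rewrite /unif_inner measure_bigsetU_ord; last 2 first.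
- by move=> i; exact: measurable_unif_cell.
- exact: trivIset_unif_cell.
rewrite -sumEFin; apply: eq_bigr => i _.
have n0 : (0 < n)%N by apply: leq_trans (ltn_ord i).
have ai : a <= unif_node a b n i by rewrite -[leLHS](unif_node0 a b n) le_unif_node.
have ib : unif_node a b n i.+1 <= b.
  by rewrite -[leRHS](unif_node_last a b n0) le_unif_node.
have ii : unif_node a b n i <= unif_node a b n i.+1 by rewrite le_unif_node.
rewrite /unif_cell [LHS]clamp_measure_itv// ger0_norm// subr_ge0 ndG// in_itv/=.
  by rewrite ai (le_trans ii).
by rewrite ib (le_trans ai).
Qed.

(** Once the mesh is below the radius of a ball around [x] inside [U], the cell containing [x] lies
    in [U]. Successive uniform partitions need not refine one another, hence a lower limit of sets
    instead of a plain union. *)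
Lemma unif_inner_cover U : open U ->
  U `&` `]a, b]%classic `<=`
    \bigcup_n \bigcap_(m in [set m | (n <= m)%N]) unif_inner U m.+1.
Proof.
move=> oU x [Ux]; rewrite /= in_itv/= => /andP[ax xb].
have [r /= r0 rU] : exists2 r, 0 < r & ball x r `<=` U.
  by have /nbhs_ballP[r r0 rU] := open_nbhs_nbhs (conj oU Ux); exists r.
exists (Num.bound ((b - a) / r)) => // m /= nm.
have [i /andP[ix xi]] := @unif_node_cell _ a b x m.+1 isT ax xb.
rewrite /unif_inner -bigcup_seq_cond; exists i; last by rewrite /unif_cell/= in_itv/= ix.
rewrite /= mem_index_enum/=; apply/asboolP => y; rewrite /unif_cell/= in_itv/= => /andP[iy yi].
apply: rU; rewrite /ball/=.
have hr : (b - a) / m.+1%:R < r.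
  rewrite ltr_pdivrMr ?ltr0n// mulrC -ltr_pdivrMr//.
  rewrite (lt_le_trans (archi_boundP _)) ?ler_nat//.
    by rewrite divr_ge0 ?subr_ge0// ltW.
  exact: leqW.
apply: le_lt_trans hr; rewrite ler_norml.
move: xi yi; rewrite !unif_nodeS; set h := _ / _ => xi yi.
by apply/andP; split; lra.
Qed.

(** Outer regularity puts [N] in an open [U] of Lebesgue measure below [d]. Every inner
    approximation of [U] then has Stieltjes measure below [e], and continuity from below carries
    this bound to [N]. *)
Lemma clamp_measure_dominated N : measurable N -> mu N = 0%E ->
  nu (N `&` `]a, b]%classic) = 0%E.
Proof.
move=> mN N0; apply/eqP; rewrite eq_le measure_ge0 andbT.
apply/lee_addgt0Pr => e e0; rewrite add0e.
have [d d0 Hd] := ac_unif_cells ab acG e0.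
have muN : (mu N < +oo)%E by rewrite N0.
have [U [oU NU Ud]] := lebesgue_regularity_outer mN muN d0.
have {}Ud : (mu U < d%:E)%E.
  rewrite -(setDUK NU) (le_lt_trans (measureU2 _ _ _))//.
  - by apply: measurableD => //; exact: open_measurable.
  - by rewrite [X in (X + _)%E](_ : _ = 0%E) ?add0e.
(* These tail intersections increase with [n], whereas the approximations themselves need not. *)
pose B n := \bigcap_(m in [set m | (n <= m)%N]) unif_inner U m.+1.
have mB n : measurable (B n).
  by apply: bigcap_measurable => [|m _]; [exists n => /=|exact: measurable_unif_inner].
have mcupB : measurable (\bigcup_n B n) by exact: bigcup_measurable.
have Be n : (nu (B n) <= e%:E)%E.
  apply: (@le_trans _ _ (nu (unif_inner U n.+1))).
    apply: le_measure; rewrite ?inE//; first exact: measurable_unif_inner.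
    by move=> x; apply; rewrite /=.
  rewrite clamp_measure_unif_inner lee_fin ltW//; apply: Hd.
  rewrite -lte_fin -lebesgue_unif_inner; apply: le_lt_trans Ud.
  apply: le_measure; rewrite ?inE; [exact: measurable_unif_inner|exact: open_measurable|].
  exact: unif_inner_sub.
apply: (@le_trans _ _ (nu (\bigcup_n B n))).
  apply: le_measure; rewrite ?inE//; first by apply: measurableI => //; exact: measurable_itv.
  by move=> x [Nx xab]; apply: unif_inner_cover => //; split => //; exact: NU.
have ndB : nondecreasing_seq B.
  move=> n m nm; apply/subsetPset => x Bx k /= mk; apply: Bx.
  exact: leq_trans nm mk.
have cB := @nondecreasing_cvg_mu _ _ _ nu B mB mcupB ndB.
rewrite -(cvg_lim _ cB)//; apply: lime_le; first by apply/cvg_ex; eexists; exact: cB.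
exact: nearW.
Qed.

End monotone_ac.

(** * Fundamental theorem of calculus for absolutely continuous functions *)

Lemma nondecreasing_ac_primitive (R : realType) (a b : R) (G : R -> R) :
  a <= b -> {in `[a, b] &, nondecreasing_fun G} -> abs_continuous_on a b G ->
  exists phi : R -> R, (@lebesgue_measure R).-integrable `[a, b] (EFin \o phi) /\
    forall x, x \in `[a, b] -> G x - G a = \int[lebesgue_measure]_(t in `[a, x]) phi t.
Proof.
move=> ab ndG acG.
pose nu := lebesgue_stieltjes_measure (clamp_cumulative ab ndG acG).
have mab : measurable (`]a, b]%classic : set (measurableTypeR R)) by exact: measurable_itv.
have nuab : (lebesgue_stieltjes_measure (clamp_cumulative ab ndG acG) `]a, b]%classic < +oo)%E.
  by rewrite clamp_measure_itv// ltry.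
(* The restriction to []a, b]] is finite, and domination by Lebesgue measure has been proved for
   exactly this restriction. *)
pose nuD : {finite_measure set (measurableTypeR R) -> \bar R} := mfrestr mab nuab.
have dom : nuD `<< (@lebesgue_measure R).
  apply/null_content_dominatesP => N mN N0.
  exact: (clamp_measure_dominated ab ndG acG mN N0).
have [g [g0 gfin gint nug]] := radon_nikodym_sigma_finite dom.
have gE : EFin \o (fine \o g) = g by apply/funext => x /=; rewrite fineK.
exists (fine \o g); split.
  by rewrite gE; apply: integrableS gint.
move=> x /[!in_itv]/= /andP[ax xb].
(* Dropping the null point [a] leaves a half-open interval, whose Stieltjes measure is the increment
   of [G]. *)
rewrite -Rintegral_itv_obnd_cbnd; last by rewrite gE; apply: integrableS gint.
rewrite /Rintegral (eq_integral g) => [|t _]; last by rewrite /= fineK.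
rewrite -[LHS]/(fine (G x - G a)%:E); congr fine.
rewrite -(nug `]a, x]%classic) ?measurable_itv//.
rewrite -(clamp_measure_itv ab ndG acG)//; congr (lebesgue_stieltjes_measure _).
rewrite setIidl// => t; rewrite /= !in_itv/= => /andP[-> /=] /le_trans; exact.
Qed.


Lemma ac_comb (R : realType) (a b c : R) (f g : R -> R) :
  abs_continuous_on a b f -> abs_continuous_on a b g ->
  abs_continuous_on a b (fun x => f x + c * g x).
Proof.
move=> acf acg e e0; have e2 : 0 < e / 2 by rewrite divr_gt0.
have c1 : 0 < `|c| + 1 by rewrite ltr_wpDl.
have [d1 d10 H1] := acf _ e2.
(* The summand 1 keeps the divisor positive when [c = 0]. *)
have [|d2 d20 H2] := acg (e / 2 / (`|c| + 1)); first by rewrite divr_gt0.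
exists (Num.min d1 d2) => [|m s t st dis]; first by rewrite lt_min d10.
rewrite lt_min => /andP[sd1 sd2]; rewrite [ltRHS]splitr.
have := H2 _ _ _ st dis sd2; rewrite ltr_pdivlMr// => {}H2.
apply: le_lt_trans (ltrD (H1 _ _ _ st dis sd1) H2).
rewrite mulr_suml -big_split/=; apply: ler_sum => k _.
have -> : f (t k) + c * g (t k) - (f (s k) + c * g (s k)) =
  f (t k) - f (s k) + c * (g (t k) - g (s k)) by ring.
rewrite (le_trans (ler_normD _ _))// lerD2l normrM mulrC ler_wpM2l//.
by rewrite lerDl.
Qed.

Lemma ac_cst (R : realType) (a b c : R) : abs_continuous_on a b (fun=> c).
Proof.
move=> e e0; exists 1 => // m s t _ _ _.
by rewrite big1// => k _; rewrite subrr normr0.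
Qed.

Lemma ac_id (R : realType) (a b : R) : abs_continuous_on a b id.
Proof.
move=> e e0; exists e => // m s t st _; apply: le_lt_trans.
apply: ler_sum => k _; rewrite ger0_norm// subr_ge0.
by have [_ []] := st _ (ltn_ord k).
Qed.

Lemma ac_bounded (R : realType) (a b : R) (f : R -> R) :
  a <= b -> abs_continuous_on a b f ->
  exists2 M, 0 <= M & forall x, x \in `[a, b] -> `|f x| <= M.
Proof.
move=> ab acf.
have cf : {within `[a, b], continuous (fun x => `|f x|)}.
  by move=> x; apply: cvg_norm; exact: (ac_continuous_within ab acf).
have [c _ Hc] := EVT_max ab cf.
by exists `|f c|.
Qed.

Lemma ac_mul (R : realType) (a b : R) (f g : R -> R) :
  a <= b -> abs_continuous_on a b f -> abs_continuous_on a b g ->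
  abs_continuous_on a b (fun x => f x * g x).
Proof.
move=> ab acf acg e e0; have e2 : 0 < e / 2 by rewrite divr_gt0.
have [M M0 fM] := ac_bounded ab acf; have [N N0 gN] := ac_bounded ab acg.
have M1 : 0 < M + 1 by rewrite ltr_wpDl.
have N1 : 0 < N + 1 by rewrite ltr_wpDl.
have [|d1 d10 H1] := acf (e / 2 / (N + 1)); first by rewrite divr_gt0.
have [|d2 d20 H2] := acg (e / 2 / (M + 1)); first by rewrite divr_gt0.
exists (Num.min d1 d2) => [|m s t st dis]; first by rewrite lt_min d10.
rewrite lt_min => /andP[sd1 sd2]; rewrite [ltRHS]splitr.
have := H1 _ _ _ st dis sd1; rewrite ltr_pdivlMr// => {}H1.
have := H2 _ _ _ st dis sd2; rewrite ltr_pdivlMr// => {}H2.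
apply: le_lt_trans (ltrD H1 H2).
rewrite !mulr_suml -big_split/=; apply: ler_sum => k _.
have [ask [skt tkb]] := st _ (ltn_ord k).
have -> : f (t k) * g (t k) - f (s k) * g (s k) =
  (f (t k) - f (s k)) * g (t k) + (g (t k) - g (s k)) * f (s k) by ring.
rewrite (le_trans (ler_normD _ _))// !normrM lerD// ler_wpM2l//.
  by rewrite (le_trans (gN _ _)) ?lerDl// in_itv/= tkb (le_trans ask).
by rewrite (le_trans (fM _ _)) ?lerDl// in_itv/= ask (le_trans skt).
Qed.

Lemma ac_sub_itv (R : realType) (a b c d : R) (f : R -> R) :
  a <= c -> d <= b -> abs_continuous_on a b f -> abs_continuous_on c d f.
Proof.
move=> ac db acf e /acf[r r0 H]; exists r => // m s t st.
apply: H => k /st[cs [sk td]]; split; first exact: le_trans cs.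
by split => //; exact: le_trans db.
Qed.

Lemma ac_integrable (R : realType) (a b : R) (f : R -> R) : a <= b ->
  abs_continuous_on a b f -> (@lebesgue_measure R).-integrable `[a, b] (EFin \o f).
Proof.
move=> ab acf; apply: continuous_compact_integrable; first exact: segment_compact.
exact: ac_continuous_within.
Qed.

(** Jordan decomposition: with [T] the variation function, [f = T - (T - f)]. Both terms are
    absolutely continuous, and nondecreasing because increments of [T] dominate those of [f] in
    absolute value. *)
Lemma ac_primitive (R : realType) (a b : R) (f : R -> R) :
  a <= b -> abs_continuous_on a b f ->
  exists phi : R -> R, (@lebesgue_measure R).-integrable `[a, b] (EFin \o phi) /\
    forall x, x \in `[a, b] -> f x - f a = \int[lebesgue_measure]_(t in `[a, x]) phi t.
Proof.
move=> ab acf; have bvf := ac_bounded_variation ab acf.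
have fin_tv x y : a <= x -> x <= y -> y <= b -> total_variation x y f \is a fin_num.
  move=> ax xy yb; apply/bounded_variationP => //.
  exact: (bounded_variationr ax xy (bounded_variationl (le_trans ax xy) yb bvf)).
pose T := fine \o (total_variation a ^~ f).
have acT : abs_continuous_on a b T := ac_total_variation ab acf.
have TD x y : a <= x -> x <= y -> y <= b -> `|f y - f x| <= T y - T x.
  move=> ax xy yb; rewrite /T/= (total_variationD f ax xy) fineD ?fin_tv//.
    by rewrite addrAC subrr add0r -lee_fin fineK ?fin_tv// total_variation_ge.
  exact: le_trans yb.
have [phi [iphi phiE]] : exists phi : R -> R,
    (@lebesgue_measure R).-integrable `[a, b] (EFin \o phi) /\
    forall x, x \in `[a, b] -> T x - T a = \int[lebesgue_measure]_(t in `[a, x]) phi t.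
  apply: nondecreasing_ac_primitive => // x y.
  rewrite !in_itv/= => /andP[ax _] /andP[_ yb] xy.
  by rewrite -subr_ge0 (le_trans _ (TD _ _ ax xy yb)).
have [psi [ipsi psiE]] : exists psi : R -> R,
    (@lebesgue_measure R).-integrable `[a, b] (EFin \o psi) /\
    forall x, x \in `[a, b] -> (T x + (-1) * f x) - (T a + (-1) * f a) =
      \int[lebesgue_measure]_(t in `[a, x]) psi t.
  apply: (@nondecreasing_ac_primitive _ a b (fun x => T x + (-1) * f x)) => //; last exact: ac_comb.
  move=> x y; rewrite !in_itv/= => /andP[ax _] /andP[_ yb] xy.
  have := TD _ _ ax xy yb; rewrite ler_norml; lra.
exists (fun x => phi x - psi x); split.
  have mab : measurable (`[a, b]%classic : set (measurableTypeR R)) by exact: measurable_itv.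
  exact: integrableB iphi ipsi.
move=> x xab.
have sub : `[a, x]%classic `<=` `[a, b]%classic.
  by move=> t; move: xab; rewrite /= !in_itv/= => /andP[_ xb] /andP[-> /le_trans]; exact.
rewrite RintegralB//; last 2 first.
- exact: integrableS iphi.
- exact: integrableS ipsi.
by rewrite -phiE// -psiE//; ring.
Qed.

(** Lebesgue differentiation of the primitive. The derivative is claimed only in the open interval,
    since at an endpoint it would involve values of [f] outside [[a, b]]. *)
Lemma ac_ae_derivable (R : realType) (a b : R) (f : R -> R) :
  a <= b -> abs_continuous_on a b f ->
  exists phi : R -> R, [/\ (@lebesgue_measure R).-integrable `[a, b] (EFin \o phi),
    \int[lebesgue_measure]_(t in `[a, b]) phi t = f b - f a &
    {ae (@lebesgue_measure R), forall x, x \in `]a, b[ -> is_derive x 1 f (phi x)}].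
Proof.
move=> ab acf; have [phi [iphi phiE]] := ac_primitive ab acf.
exists phi; split => //; first by rewrite -phiE// in_itv/= lexx ab.
(* Extension by zero makes the density integrable on the whole line, as the differentiation theorem
   is applied there. *)
pose psi := phi \_ `[a, b].
have mab : measurable (`[a, b]%classic : set (measurableTypeR R)) by exact: measurable_itv.
have ipsi y : (@lebesgue_measure R).-integrable `[a, y] (EFin \o psi).
  apply: (@integrableS _ _ _ _ setT) => //.
  by move/integrable_mkcond : iphi; rewrite restrict_EFin; exact.
have lpsi : locally_integrable [set: R] psi by exact: integrable_locally.
have := @FTC1 R psi (BLeft a) ipsi lpsi.
apply: filterS; first exact: (ae_filter_ringOfSetsType (@lebesgue_measure R)).
move=> x Hx.
rewrite in_itv/= => /andP[ax xb].
have [|dF F'] := Hx; first by rewrite /= lte_fin.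
pose F y := \int[lebesgue_measure]_(t in `[a, y]) psi t.
have dF' : is_derive x 1 F (phi x).
  apply: DeriveDef => //; rewrite -derive1E F' /psi patchE mem_set//=.
  by rewrite in_itv/= !ltW.
(* The 0 is the derivative of the constant [f a]: near [x], [f] equals [F] plus that constant. *)
have -> : phi x = phi x + 0 by rewrite addr0.
apply: (@near_eq_is_derive _ _ _ (fun y => F y + f a)).
  near=> y.
  have yab : y \in `[a, b].
    have : y \in `]a, b[ by near: y; apply: near_in_itvoo; rewrite in_itv/= ax.
    by rewrite !in_itv/= => /andP[/ltW -> /ltW ->].
  rewrite -[RHS](subrK (f a)) phiE//; congr (_ + _).
  apply: eq_Rintegral => t; rewrite inE/= /psi patchE => tay; rewrite mem_set//.
  move: yab tay; rewrite /= !in_itv/= => /andP[_ yb] /andP[-> /le_trans]; exact.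
Unshelve. all: by end_near. Qed.

(** * Quadrature error estimate *)

Lemma ae_itvcc_itvoo (R : realType) (a b : R) :
  {ae (@lebesgue_measure R), forall x, x \in `[a, b] -> x \in `]a, b[}.
Proof.
exists [set a; b]; split => [||x /=].
- by apply: measurableU; exact: measurable_set1.
- by apply: countable_lebesgue_measure0; exact/finite_set_countable.
rewrite !in_itv/= => /not_implyP[/andP[ax xb] /negP]; rewrite negb_and -!leNgt.
by move=> /orP[xa|bx]; [left|right]; apply/eqP; rewrite eq_le ?ax ?xa ?xb ?bx.
Qed.

(** Almost everywhere [g - f] equals its positive part, whose integral is nonnegative. *)
Lemma ae_le_Rintegral (R : realType) (D : set (measurableTypeR R)) (f g : R -> R) :
  measurable D -> (@lebesgue_measure R).-integrable D (EFin \o f) ->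
  (@lebesgue_measure R).-integrable D (EFin \o g) ->
  {ae (@lebesgue_measure R), forall x, D x -> f x <= g x} ->
  \int[lebesgue_measure]_(x in D) f x <= \int[lebesgue_measure]_(x in D) g x.
Proof.
move=> mD intf intg fg; rewrite -subr_ge0 -RintegralB//.
have mf := measurable_int _ intf; have mg := measurable_int _ intg.
have mgf : measurable_fun D (fun x => g x - f x).
  by apply: measurable_funB; exact/measurable_EFinP.
rewrite (_ : \int[_]_(x in D) _ =
    \int[lebesgue_measure]_(x in D) Num.max (g x - f x) 0); last first.
  congr fine; apply: ae_eq_integral => //; first exact/measurable_EFinP.
    by apply/measurable_EFinP; exact: measurable_maxr.
  apply: filterS fg.
  by move=> x + Dx => /(_ Dx) fgx; rewrite max_l// subr_ge0.
by apply: Rintegral_ge0 => x _; rewrite le_max lexx orbT.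
Qed.

Lemma ae_eq_Rintegral (R : realType) (D : set (measurableTypeR R)) (f g : R -> R) :
  measurable D -> measurable_fun D f -> measurable_fun D g ->
  {ae (@lebesgue_measure R), forall x, D x -> f x = g x} ->
  \int[lebesgue_measure]_(x in D) f x = \int[lebesgue_measure]_(x in D) g x.
Proof.
move=> mD mf mg fg; congr fine; apply: ae_eq_integral => //; try exact/measurable_EFinP.
apply: filterS fg.
by move=> x + Dx => /(_ Dx) ->.
Qed.

Lemma Rintegral_itv_cst (R : realType) (p q r : R) : p <= q ->
  \int[lebesgue_measure]_(_ in `[p, q]) r = r * (q - p).
Proof.
move=> pq; rewrite Rintegral_cst//; congr (_ * _).
have -> : q - p = fine (q - p)%:E by [].
congr fine; rewrite [LHS]lebesgue_measure_itv/= lte_fin.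
by move: pq; rewrite le_eqVlt => /predU1P[->|->//]; rewrite ltxx subrr.
Qed.

Lemma integrable_sub_itv (R : realType) (p q s t : R) (g : R -> R) : p <= s -> t <= q ->
  (@lebesgue_measure R).-integrable `[p, q] (EFin \o g) ->
  (@lebesgue_measure R).-integrable `[s, t] (EFin \o g).
Proof.
by move=> ps tq; apply: integrableS => //; apply: subset_itv; rewrite bnd_simp.
Qed.

Lemma Rintegral_itv_split (R : realType) (p m q : R) (g : R -> R) :
  p <= m -> m <= q -> (@lebesgue_measure R).-integrable `[p, q] (EFin \o g) ->
  \int[lebesgue_measure]_(x in `[p, q]) g x =
  \int[lebesgue_measure]_(x in `[p, m]) g x + \int[lebesgue_measure]_(x in `[m, q]) g x.
Proof.
move=> pm mq ig; apply/eqP; rewrite addrC -subr_eq.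
rewrite (@Rintegral_itvB _ _ (BLeft p) (BRight q) m)//.
apply/eqP; rewrite Rintegral_itv_obnd_cbnd//.
apply: integrableS ig => //; last by apply: subset_itv; rewrite bnd_simp.
Qed.

Lemma Rintegral_unif_node (R : realType) (a b : R) (g : R -> R) n :
  a <= b -> (0 < n)%N -> (@lebesgue_measure R).-integrable `[a, b] (EFin \o g) ->
  \int[lebesgue_measure]_(x in `[a, b]) g x =
  \sum_(i < n) \int[lebesgue_measure]_(x in `[unif_node a b n i, unif_node a b n i.+1]) g x.
Proof.
move=> ab n0 ig.
(* The induction is on the number of cells with [n] fixed, because the mesh depends on [n]. *)
suff H k : (k <= n)%N -> \int[lebesgue_measure]_(x in `[a, unif_node a b n k]) g x =
  \sum_(i < k) \int[lebesgue_measure]_(x in `[unif_node a b n i, unif_node a b n i.+1]) g x.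
  by rewrite -H// unif_node_last.
elim: k => [_|k IH kn]; first by rewrite big_ord0 unif_node0 set_itv1 Rintegral_set1.
rewrite big_ord_recr/= -IH ?(ltnW kn)//; apply: Rintegral_itv_split.
- by rewrite -[leLHS](unif_node0 a b n) le_unif_node.
- by rewrite le_unif_node.
apply: integrableS ig => //; apply: subset_itvl; rewrite bnd_simp.
by rewrite -[leRHS](unif_node_last a b n0) le_unif_node.
Qed.

(* With [u := f' - c] the derivative of the left-hand function is
   [2 al (z - x) u - al^2 (z - x)^2 - 2 al (f x - f y)], and completing the
   square bounds its first two terms by [u^2]. *)
Lemma ac_kernel_estimate (R : realType) (p q y z c al : R) (f : R -> R) :
  p <= q -> abs_continuous_on p q f ->
  (@lebesgue_measure R).-integrable `[p, q] (EFin \o (fun x => (derive1 f x - c) ^+ 2)) ->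
  let U x := (z - x) * (2 * al * (f x - f y) + al * c * (z - x) + al ^+ 2 * (z - x) ^+ 2 / 3) in
  is_true (U q - U p <= \int[lebesgue_measure]_(x in `[p, q]) (derive1 f x - c) ^+ 2
    - 2 * al * (\int[lebesgue_measure]_(x in `[p, q]) f x - (q - p) * f y)).
Proof.
move=> pq acf iD U.
have mpq : measurable (`[p, q]%classic : set (measurableTypeR R)) by exact: measurable_itv.
have acU : abs_continuous_on p q U.
  have acz : abs_continuous_on p q (fun x => z + (-1) * id x).
    by apply: ac_comb; [exact: ac_cst|exact: ac_id].
  (* This form uses only sums and products of absolutely continuous functions, as [ac_comb] and
     [ac_mul] require. *)
  have -> : U = (fun x => (z + (-1) * x) * ((z + (-1) * x) *
      (al * c + (al ^+ 2 / 3) * (z + (-1) * x)) + (2 * al) * (f x + (-1) * f y))).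
    by apply/funext => x; rewrite /U; ring.
  apply: (ac_mul pq acz); apply: ac_comb; last exact: ac_comb (ac_cst _ _ _).
  by apply: (ac_mul pq acz); apply: ac_comb => //; exact: ac_cst.
have [phi [iphi phiE dphi]] := ac_ae_derivable pq acU.
have [psi [_ _ dpsi]] := ac_ae_derivable pq acf.
rewrite -phiE.
have icst r : (@lebesgue_measure R).-integrable `[p, q] (EFin \o (fun=> r)).
  exact: ac_integrable (ac_cst _ _ _).
have ify : (@lebesgue_measure R).-integrable `[p, q] (EFin \o (fun x => f x - f y)).
  exact: integrableB (ac_integrable pq acf) (icst (f y)).
have ialf : (@lebesgue_measure R).-integrable `[p, q] (EFin \o (fun x => 2 * al * (f x - f y))).
  exact: integrableZl ify.
have -> : \int[lebesgue_measure]_(x in `[p, q]) (derive1 f x - c) ^+ 2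
    - 2 * al * (\int[lebesgue_measure]_(x in `[p, q]) f x - (q - p) * f y) =
  \int[lebesgue_measure]_(x in `[p, q]) ((derive1 f x - c) ^+ 2 - 2 * al * (f x - f y)).
  rewrite RintegralB// RintegralZl// RintegralB//; last exact: ac_integrable.
  by rewrite Rintegral_itv_cst//; ring.
apply: ae_le_Rintegral => //; first exact: integrableB iD ialf.
apply: filterS3 dphi dpsi (ae_itvcc_itvoo p q).
  exact: (ae_filter_ringOfSetsType (@lebesgue_measure R)).
move=> x dU df xoo /xoo xpq.
have {}dU := dU xpq; have {}df := df xpq.
have -> : phi x = 2 * al * (z - x) * (derive1 f x - c) - al ^+ 2 * (z - x) ^+ 2
    - 2 * al * (f x - f y).
  rewrite derive1E; have -> : 'D_1 f x = psi x by exact: derive_val.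
  have <- : 'D_1 U x = phi x by exact: derive_val.
  pose L : R -> R := cst z - id.
  have dL : is_derive x 1 L (-1) by apply: is_derive_eq; rewrite sub0r.
  have UE : U = L * ((2 * al) *: (f - cst (f y)) + (al * c) *: L + (al ^+ 2 / 3) *: (L * L)).
    by apply/funext => t; rewrite /U /L !fctE/= /GRing.scale/=; ring.
  have dU' : is_derive x 1 U (2 * al * (z - x) * (psi x - c) - al ^+ 2 * (z - x) ^+ 2
      - 2 * al * (f x - f y)).
    rewrite UE; apply: is_derive_eq.
    by rewrite /L !fctE/= /GRing.scale/=; field.
  exact: derive_val.
rewrite lerB// -subr_ge0.
have -> : (derive1 f x - c) ^+ 2 - (2 * al * (z - x) * (derive1 f x - c) - al ^+ 2 * (z - x) ^+ 2)
  = (derive1 f x - c - al * (z - x)) ^+ 2 by ring.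
exact: sqr_ge0.
Qed.

(** The kernel estimate is used on each half with [z] the outer endpoint, so [U] vanishes there. The
    boundary terms [al * c * v ^+ 2] of the two halves have opposite signs and cancel. *)
Lemma ac_midpoint_estimate (R : realType) (p q y v c al : R) (f : R -> R) : 0 <= v ->
  p = y - v -> q = y + v -> abs_continuous_on p q f ->
  (@lebesgue_measure R).-integrable `[p, q] (EFin \o (fun x => (derive1 f x - c) ^+ 2)) ->
  2 * al * (\int[lebesgue_measure]_(x in `[p, q]) f x - 2 * v * f y) <=
    2 * al ^+ 2 * v ^+ 3 / 3 + \int[lebesgue_measure]_(x in `[p, q]) (derive1 f x - c) ^+ 2.
Proof.
move=> v0 pE qE acf iD.
have py : p <= y by rewrite pE lerBlDr lerDl.
have yq : y <= q by rewrite qE lerDl.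
have iF := ac_integrable (le_trans py yq) acf.
rewrite (Rintegral_itv_split py yq iF) (Rintegral_itv_split py yq iD).
have := @ac_kernel_estimate R p y y p c al f py (ac_sub_itv (lexx _) yq acf)
  (integrable_sub_itv (lexx _) yq iD).
have := @ac_kernel_estimate R y q y q c al f yq (ac_sub_itv py (lexx _) acf)
  (integrable_sub_itv py (lexx _) iD).
rewrite /= !subrr !(mul0r, mulr0, add0r, sub0r, subr0).
have -> : y - p = v by rewrite pE; ring.
have -> : q - y = v by rewrite qE; ring.
have -> : p - y = - v by rewrite pE; ring.
set I1 := Rintegral _ _ _; set I2 := Rintegral _ _ _.
set I3 := Rintegral _ _ _; set I4 := Rintegral _ _ _.
by lra.
Qed.

(** The two nodes are the midpoints of the two halves of [[p, q]], so the midpoint estimates add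
    up. *)
Lemma ac_two_point_estimate (R : realType) (p q v c al : R) (f : R -> R) : 0 <= v ->
  q = p + 4 * v -> abs_continuous_on p q f ->
  (@lebesgue_measure R).-integrable `[p, q] (EFin \o (fun x => (derive1 f x - c) ^+ 2)) ->
  2 * al * (\int[lebesgue_measure]_(x in `[p, q]) f x
      - 2 * v * (f ((3 * p + q) / 4) + f ((p + 3 * q) / 4))) <=
    4 * al ^+ 2 * v ^+ 3 / 3 +
    \int[lebesgue_measure]_(x in `[p, q]) (derive1 f x - c) ^+ 2.
Proof.
move=> v0 qE acf iD; pose m := p + 2 * v.
have pm : p <= m by rewrite /m; lra.
have mq : m <= q by rewrite /m qE; lra.
have iF := ac_integrable (le_trans pm mq) acf.
rewrite (Rintegral_itv_split pm mq iF) (Rintegral_itv_split pm mq iD).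
have := @ac_midpoint_estimate R p m ((3 * p + q) / 4) v c al f v0 _ _
  (ac_sub_itv (lexx _) mq acf)
  (integrable_sub_itv (lexx _) mq iD).
have := @ac_midpoint_estimate R m q ((p + 3 * q) / 4) v c al f v0 _ _
  (ac_sub_itv pm (lexx _) acf)
  (integrable_sub_itv pm (lexx _) iD).
set I1 := Rintegral _ _ _; set I2 := Rintegral _ _ _.
set I3 := Rintegral _ _ _; set I4 := Rintegral _ _ _.
move=> H1 H2.
have {}H1 := H1 ltac:(rewrite /m qE; field) ltac:(rewrite qE; field).
have {}H2 := H2 ltac:(rewrite qE; field) ltac:(rewrite /m qE; field).
by lra.
Qed.

(** Here [c] is the mean of [f'], as [f'] integrates to [f b - f a]; expanding the square identifies
    [sigma_d] with a variance-type integral. *)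
Lemma sigma_d_integral (R : realType) (a b : R) (f : R -> R) : a < b ->
  abs_continuous_on a b f -> measurable_fun `[a, b] (derive1 f) ->
  (\int[lebesgue_measure]_(x in `[a, b]) ((derive1 f x) ^+ 2)%:E < +oo)%E ->
  let c := (f b - f a) / (b - a) in
  (@lebesgue_measure R).-integrable `[a, b] (EFin \o (fun x => (derive1 f x - c) ^+ 2)) /\
  \int[lebesgue_measure]_(x in `[a, b]) (derive1 f x - c) ^+ 2 = sigma_d a b f.
Proof.
move=> ab acf mD fD c.
have mab : measurable (`[a, b]%classic : set (measurableTypeR R)) by exact: measurable_itv.
have iD2 : (@lebesgue_measure R).-integrable `[a, b] (EFin \o (fun x => derive1 f x ^+ 2)).
  apply/integrableP; split; first by apply/measurable_EFinP; exact: measurable_funX.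
  by under eq_integral do rewrite /= ger0_norm ?sqr_ge0//.
have icst r : (@lebesgue_measure R).-integrable `[a, b] (EFin \o (fun=> r)).
  exact: ac_integrable (ltW ab) (ac_cst _ _ _).
have iD : (@lebesgue_measure R).-integrable `[a, b] (EFin \o derive1 f).
  (* On a bounded interval square integrability gives integrability, through [|D| <= 1 + D^2], which
     follows from [(D + 1)^2 >= 0] or [(D - 1)^2 >= 0] according to the sign of [D]. *)
  have i1D2 : (@lebesgue_measure R).-integrable `[a, b] (EFin \o (fun x => 1 + derive1 f x ^+ 2)).
    exact: integrableD (icst 1) iD2.
  apply: le_integrable i1D2 => //; first exact/measurable_EFinP.
  move=> x _ /=; rewrite lee_fin [leRHS]ger0_norm ?addr_ge0 ?sqr_ge0//.
  have [D0|D0] := ler0P; first by have := sqr_ge0 (derive1 f x + 1); lra.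
  by have := sqr_ge0 (derive1 f x - 1); lra.
have icD : (@lebesgue_measure R).-integrable `[a, b] (EFin \o (fun x => 2 * c * derive1 f x)).
  exact: integrableZl iD.
have iDcD : (@lebesgue_measure R).-integrable `[a, b]
    (EFin \o (fun x => derive1 f x ^+ 2 - 2 * c * derive1 f x)).
  exact: integrableB iD2 icD.
have E : (fun x => (derive1 f x - c) ^+ 2) =
    (fun x => derive1 f x ^+ 2 - 2 * c * derive1 f x + c ^+ 2).
  by apply/funext => x; ring.
rewrite E; split; first exact: integrableD iDcD (icst _).
rewrite RintegralD// RintegralB// RintegralZl// Rintegral_itv_cst ?(ltW ab)//.
have [phi [iphi phiE dphi]] := ac_ae_derivable (ltW ab) acf.
have -> : \int[lebesgue_measure]_(x in `[a, b]) derive1 f x = f b - f a.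
  rewrite -phiE; apply: ae_eq_Rintegral => //.
    by apply/measurable_EFinP; exact: measurable_int iphi.
  apply: filterS2 dphi (ae_itvcc_itvoo a b).
    exact: (ae_filter_ringOfSetsType (@lebesgue_measure R)).
  move=> x df xoo /xoo /df {}df.
  by rewrite derive1E; exact: derive_val.
rewrite /sigma_d /L2norm_sq /c; field.
by rewrite subr_eq0 gt_eqF.
Qed.

Unset Implicit Arguments.

Theorem theorem3p3 (R : realType) (a b : R) (n : nat) (f : R -> R) :
  a < b -> (1 <= n)%N ->
  abs_continuous_on a b f ->
  measurable_fun `[a, b] (derive1 f) ->
  (\int[lebesgue_measure]_(x in `[a, b]) ((derive1 f x) ^+ 2)%:E < +oo)%E ->
  `| R_rem a b n f | <=
    (b - a) `^ (3 / 2) / (4 * Num.sqrt 3 * n%:R) * Num.sqrt (sigma_d a b f).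
Proof.
move=> ab n0 acf mD fD.
have [] := sigma_d_integral ab acf mD fD; set c := (f b - f a) / (b - a) => iD sigmaE.
(* [C] is [n] times [4 * v ^+ 3 / 3], where [v = (b - a) / (4 n)] is a quarter of a cell. *)
set C := (b - a) ^+ 3 / (48 * n%:R ^+ 2).
have nR0 : n%:R != 0 :> R by rewrite pnatr_eq0 -lt0n.
have C0 : 0 < C by rewrite divr_gt0 ?exprn_gt0 ?subr_gt0// mulr_gt0 ?exprn_gt0// ltr0n.
have key al : 2 * al * R_rem a b n f <= al ^+ 2 * C + sigma_d a b f.
  have iF := ac_integrable (ltW ab) acf.
  rewrite -sigmaE /R_rem /S_quad (Rintegral_unif_node (ltW ab) n0 iF).
  rewrite (Rintegral_unif_node (ltW ab) n0 iD) mulr_sumr -sumrB mulr_sumr.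
  pose v := (b - a) / n%:R / 4.
  have -> : al ^+ 2 * C = \sum_(i < n) 4 * al ^+ 2 * v ^+ 3 / 3.
    by rewrite sumr_const card_ord -mulr_natr /C /v; field.
  rewrite -big_split/=; apply: ler_sum => i _.
  have -> : (b - a) / n%:R / 2 = 2 * v by rewrite /v; field.
  have ai : a <= unif_node a b n i by rewrite -[leLHS](unif_node0 a b n) le_unif_node// ltW.
  have ib : unif_node a b n i.+1 <= b.
    by rewrite -[leRHS](unif_node_last a b n0) le_unif_node// ltW.
  apply: ac_two_point_estimate.
  - by rewrite !divr_ge0// subr_ge0 ltW.
  - by rewrite unif_nodeS /v; field.
  - exact: ac_sub_itv acf.
  - exact: integrable_sub_itv iD.
have s0 : 0 <= sigma_d a b f by have := key 0; rewrite !(mulr0, mul0r, expr0n)/= add0r.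
have RC : R_rem a b n f ^+ 2 <= C * sigma_d a b f.
  (* This [al] maximizes [2 al R - al^2 C], with maximum [R^2 / C]. *)
  have := key (R_rem a b n f / C); rewrite -(ler_pM2l C0).
  have -> : C * (2 * (R_rem a b n f / C) * R_rem a b n f) = 2 * R_rem a b n f ^+ 2.
    by field; rewrite gt_eqF.
  have -> : C * ((R_rem a b n f / C) ^+ 2 * C + sigma_d a b f) =
      R_rem a b n f ^+ 2 + C * sigma_d a b f by field; rewrite gt_eqF.
  lra.
have K0 : 0 <= (b - a) `^ (3 / 2) / (4 * Num.sqrt 3 * n%:R).
  by rewrite divr_ge0 ?powR_ge0// !mulr_ge0 ?sqrtr_ge0.
(* Both sides are nonnegative, so their squares are compared; [(4 sqrt 3 n)^2 = 48 n^2] recovers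
   [C]. *)
rewrite -(ler_pXn2r (n := 2))// ?nnegrE ?(mulr_ge0 K0) ?sqrtr_ge0//.
rewrite -normrX ger0_norm ?sqr_ge0// exprMn sqr_sqrtr//.
apply: le_trans RC _; rewrite le_eqVlt; apply/orP; left; apply/eqP; congr (_ * _).
rewrite expr_div_n !exprMn sqr_sqrtr//.
have -> : (b - a) `^ (3 / 2) ^+ 2 = (b - a) ^+ 3.
  rewrite -[LHS]powR_mulrn ?powR_ge0// -powRrM.
  have -> : 3 / 2 * 2%:R = 3%:R :> R by field.
  by rewrite powR_mulrn ?subr_ge0 ?(ltW ab).
by rewrite /C; congr (_ / _); ring.
Qed.
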